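(* Let $K$ be a field and $\mathcal E: y^2+a_1xy+a_3y=x^3+a_2x^2+a_4x$ an elliptic curve over $K$, with $S=(0,0)$, and let $\alpha,\beta,\gamma$ be constants depending only on the model such that, for every point $M$ of $\mathcal E$, the numbers $e_h=-x(M+hS)$ satisfy for all integers $h$ $$e_{h-1}e_h^2e_{h+1}=\alpha^2e_h-\beta,\qquad (e_{h-1}+e_{h+1})e_h^2=\gamma e_h-\alpha^2 .$$ Fix a point $M$ with $M+hS$ affine and $e_h\neq0$ for all $h\in\mathbb Z$, and let $(A_h)_{h\in\mathbb Z}$ be a sequence of nonzero elements with $A_{h-1}A_{h+1}=e_hA_h^2$ for all $h\in\mathbb Z$. Put $\bar e_h=-x(hS)$ for $h\neq0$ (assume $hS\neq O$ for $h\neq0$), and let $(W_h)_{h\in\mathbb Z}$ be the sequence with $W_{-h}=-W_h$, $W_0=0$, $W_1=1$, $W_2=\alpha$, and $W_{h-1}W_{h+1}=\bar e_hW_h^2$ for all $h\geq1$. Then for all integers $h$ and $m$, $$W_1^2A_{h-m}A_{h+m}=W_m^2A_{h-1}A_{h+1}-W_{m-1}W_{m+1}A_h^2$$ and $$W_1W_2A_{h-m}A_{h+m+1}=W_mW_{m+1}A_{h-1}A_{h+2}-W_{m-1}W_{m+2}A_hA_{h+1}.$$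
   Context: $x(P)$ denotes the $x$-coordinate of a point $P\neq O$ of $\mathcal E$, with $O$ the point at infinity. Note $\bar e_1=-x(S)=0$, and the sequence $(W_h)$ is determined by $W_0=0$, $W_1=1$, $W_2=\alpha$ and its recursion (one finds $W_3=\beta$). The sequence $(A_h)$ is called an elliptic sequence and satisfies the Somos-4 relation $A_{h-2}A_{h+2}=\alpha^2A_{h-1}A_{h+1}-\beta A_h^2$; the theorem asserts it satisfies three-term relations of every gap. *)

(* Defs.v *)
From mathcomp Require Import all_boot all_order all_algebra.

Set Implicit Arguments.
Unset Strict Implicit.
Unset Printing Implicit Defensive.

Import Order.TTheory GRing.Theory Num.Theory.
Local Open Scope ring_scope.

(* y^2 + a1 x y + a3 y = x^3 + a2 x^2 + a4 x + a6 *)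
Record weierstrass (K : fieldType) := Weierstrass {
  ca1 : K; ca2 : K; ca3 : K; ca4 : K; ca6 : K }.

(* Points of the projective plane curve: the point at infinity O, and pairs of
   affine coordinates, not yet required to satisfy the equation. *)
Inductive point (K : fieldType) := Inf | Aff of K & K.
Arguments Inf {K}.

Section Curve.
Variables (K : fieldType) (E : weierstrass K).

Local Notation a1 := (ca1 E).
Local Notation a2 := (ca2 E).
Local Notation a3 := (ca3 E).
Local Notation a4 := (ca4 E).
Local Notation a6 := (ca6 E).

Definition b2 : K := a1 ^+ 2 + 4%:R * a2.
Definition b4 : K := 2%:R * a4 + a1 * a3.
Definition b6 : K := a3 ^+ 2 + 4%:R * a6.
Definition b8 : K :=
  a1 ^+ 2 * a6 + 4%:R * a2 * a6 - a1 * a3 * a4 + a2 * a3 ^+ 2 - a4 ^+ 2.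

Definition disc : K :=
  - b2 ^+ 2 * b8 - 8%:R * b4 ^+ 3 - 27%:R * b6 ^+ 2 + 9%:R * b2 * b4 * b6.

(* The discriminant criterion is valid in every characteristic. *)
Definition elliptic : Prop := disc != 0.

Definition on_curve (P : point K) : Prop :=
  match P with
  | Inf => True
  | Aff x y =>
      y ^+ 2 + a1 * x * y + a3 * y = x ^+ 3 + a2 * x ^+ 2 + a4 * x + a6
  end.

Definition ec_opp (P : point K) : point K :=
  match P with
  | Inf => Inf
  | Aff x y => Aff x (- y - a1 * x - a3)
  end.

(* Slope of the line through (x1, y1) and (x2, y2), or of the tangent when the
   two points coincide; used only when the points are not opposite. *)
Definition ec_slope (x1 y1 x2 y2 : K) : K :=
  if x1 == x2
  then (3%:R * x1 ^+ 2 + 2%:R * a2 * x1 + a4 - a1 * y1)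
         / (2%:R * y1 + a1 * x1 + a3)
  else (y2 - y1) / (x2 - x1).

(* Chord-and-tangent law: the third intersection point (x3, y3) of the line with
   the curve is reflected by ec_opp. *)
Definition ec_add (P Q : point K) : point K :=
  match P, Q with
  | Inf, _ => Q
  | _, Inf => P
  | Aff x1 y1, Aff x2 y2 =>
      if (x1 == x2) && (y2 == - y1 - a1 * x1 - a3) then Inf
      else
        let l := ec_slope x1 y1 x2 y2 in
        let x3 := l ^+ 2 + a1 * l - a2 - x1 - x2 in
        let y3 := l * (x3 - x1) + y1 in
        ec_opp (Aff x3 y3)
  end.

Definition ec_muln (n : nat) (P : point K) : point K :=
  iter n (ec_add^~ P) Inf.

(* Negz n is the integer - n.+1. *)
Definition ec_mulz (h : int) (P : point K) : point K :=
  match h with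
  | Posz n => ec_muln n P
  | Negz n => ec_opp (ec_muln n.+1 P)
  end.

End Curve.

(* The value 0 at infinity is a dummy: xcoord is meaningful on affine points
   only. *)
Definition xcoord (K : fieldType) (P : point K) : K :=
  match P with
  | Inf => 0
  | Aff x _ => x
  end.

(* Main.v *)
Require Import Defs.
From mathcomp Require Import all_boot all_order all_algebra.
From mathcomp Require Import ring zify.

(** Dividing by [A_h^2 W_m^2], resp. by [A_h A_(h+1) W_m W_(m+1)], the two
    relations say that [A_(h-m) A_(h+m)] is given by [e_h - ebar_m], and
    [alpha A_(h-m) A_(h+m+1)] by [e_h e_(h+1) - ebar_m ebar_(m+1)].  The
    product and sum relations put consecutive terms [(p, q)] of both sequences
    on the symmetric biquadratic curve
    [(p q)^2 - gamma p q + alpha^2 (p + q) - beta = 0], which yields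
    [alpha^2 (p - y) (q - y) = y (p q - x y) (p q - y z)] when [x, y, z] are
    consecutive.  Induct on [m], alternating between the two relations: the
    products of the first at [(h, m)], [(h+1, m)] and of the second at
    [(h, m-1)], [(h, m)] involve the same four terms of [A], as do those of
    the second at [(h, m)], [(h-1, m)] and of the first at [(h, m)],
    [(h, m+1)]. *)

Set Implicit Arguments.
Unset Strict Implicit.
Unset Printing Implicit Defensive.

Import Order.TTheory GRing.Theory Num.Theory.
Local Open Scope ring_scope.

Section EllipticSequence.
Variables (K : fieldType) (alpha beta gamma : K).

Definition linked (x y z : K) : Prop :=
  x * y ^+ 2 * z = alpha ^+ 2 * y - beta /\
  (x + z) * y ^+ 2 = gamma * y - alpha ^+ 2.

Definition biquadratic (p q : K) : Prop :=
  (p * q) ^+ 2 - gamma * (p * q) + alpha ^+ 2 * (p + q) - beta = 0.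

Lemma linked_biquadratic (x y z : K) : linked x y z -> biquadratic x y.
Proof.
rewrite /biquadratic => -[/eqP + /eqP]; rewrite -subr_eq0 => /eqP prodE.
rewrite -subr_eq0 => /eqP sumE.
transitivity (x * ((x + z) * y ^+ 2 - (gamma * y - alpha ^+ 2))
  - (x * y ^+ 2 * z - (alpha ^+ 2 * y - beta))); first by ring.
by rewrite prodE sumE mulr0 subr0.
Qed.

(** As a polynomial in [p * q], the right side has coefficients symmetric in [x] and [z], which the
    two relations express through [y] alone. The two sides then differ by [y] times the biquadratic
    at [(p, q)]. *)
Lemma biquadratic_linked (p q x y z : K) :
  biquadratic p q -> linked x y z ->
  alpha ^+ 2 * ((p - y) * (q - y)) = y * ((p * q - x * y) * (p * q - y * z)).
Proof.
move=> pq [prodE sumE].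
transitivity (y * (p * q) ^+ 2 - (x + z) * y ^+ 2 * (p * q)
  + y * (x * y ^+ 2 * z)); last by ring.
rewrite prodE sumE; apply/eqP; rewrite -subr_eq0; apply/eqP.
transitivity (- y * ((p * q) ^+ 2 - gamma * (p * q)
  + alpha ^+ 2 * (p + q) - beta)); first by ring.
by rewrite pq mulr0.
Qed.

Variables (e A : int -> K) (ebar W : nat -> K).
Hypothesis alpha_neq0 : alpha != 0.
Hypothesis e_linked : forall h, linked (e (h - 1)) (e h) (e (h + 1)).
Hypothesis A_neq0 : forall h, A h != 0.
Hypothesis A_rec : forall h, A (h - 1) * A (h + 1) = e h * A h ^+ 2.
Hypothesis ebar_linked : forall n, linked (ebar n.+1) (ebar n.+2) (ebar n.+3).
Hypothesis ebar1 : ebar 1 = 0.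
Hypotheses (W1 : W 1 = 1) (W2 : W 2 = alpha).
Hypothesis W_rec : forall n, W n * W n.+2 = ebar n.+1 * W n.+1 ^+ 2.

Let even_gap n := forall h : int,
  A (h - n%:Z) * A (h + n%:Z) = (W n * A h) ^+ 2 * (e h - ebar n).

Let odd_gap n := forall h : int,
  alpha * (A (h - n%:Z) * A (h + n%:Z + 1)) =
  W n * W n.+1 * (A h * A (h + 1)) * (e h * e (h + 1) - ebar n * ebar n.+1).

Lemma e_biquadratic h : biquadratic (e h) (e (h + 1)).
Proof.
by have := linked_biquadratic (e_linked (h + 1)); rewrite !addrK.
Qed.

Lemma ebar_neq0 n : ebar n.+2 != 0.
Proof.
apply/eqP => ebar0; have [_] := ebar_linked n.
rewrite ebar0 expr0n !mulr0 sub0r => /esym/eqP.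
by rewrite oppr_eq0 expf_eq0 (negPf alpha_neq0).
Qed.

(** Bounded induction, as the recursion jumps by two. From [W 3] on it involves only [ebar n.+2],
    never the vanishing [ebar 1]. *)
Lemma W_neq0 n : W n.+1 != 0.
Proof.
elim: n {-2}n (leqnn n) => [|k IHk] [|[|n]] // lenk;
  rewrite ?W1 ?W2 ?oner_neq0 //.
have: W n.+1 * W n.+3 != 0.
  by rewrite W_rec mulf_neq0 ?ebar_neq0 // expf_neq0 // IHk //; lia.
by rewrite mulf_eq0 negb_or => /andP[].
Qed.

(** The biquadratic pair comes from [ebar], the linked triple from [e]. Of the two factors on the
    left of [key], one belongs to the known even gap and cancels; the other is the new one. *)
Lemma even_gap_succ n : even_gap n.+1 -> odd_gap n.+1 -> even_gap n.+2.
Proof.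
move=> even odd h.
have AA_neq0 : alpha ^+ 2 * (A (h - n.+1%:Z) * A (h + n.+1%:Z)) != 0.
  by rewrite !mulf_neq0 ?expf_neq0.
apply: (mulfI AA_neq0).
have key := biquadratic_linked (linked_biquadratic (ebar_linked n))
  (e_linked h).
have eA := A_rec h.
have := odd h; have := odd (h - 1); rewrite subrK.
have -> : h - 1 - n.+1%:Z = h - n.+2%:Z by lia.
have -> : h - 1 + n.+1%:Z + 1 = h + n.+1%:Z by lia.
have -> : h + n.+1%:Z + 1 = h + n.+2%:Z by lia.
move=> oddP odd0.
transitivity ((alpha * (A (h - n.+2%:Z) * A (h + n.+1%:Z)))
  * (alpha * (A (h - n.+1%:Z) * A (h + n.+2%:Z)))); first by ring.
rewrite oddP odd0 even.
transitivity ((W n.+1 * W n.+2 * A h) ^+ 2 * (A (h - 1) * A (h + 1))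
  * ((ebar n.+1 * ebar n.+2 - e (h - 1) * e h)
     * (ebar n.+1 * ebar n.+2 - e h * e (h + 1)))); first by ring.
(* This supplies the factor [e h] on the right of [key]. *)
rewrite eA.
transitivity ((W n.+1 * W n.+2 * A h ^+ 2) ^+ 2
  * (e h * ((ebar n.+1 * ebar n.+2 - e (h - 1) * e h)
     * (ebar n.+1 * ebar n.+2 - e h * e (h + 1))))); first by ring.
by rewrite -key; ring.
Qed.

(** The roles are exchanged: the pair comes from [e], the triple from [ebar], and the extra factor
    [ebar n.+2] is absorbed by the recursion of [W]. *)
Lemma odd_gap_succ n : odd_gap n.+1 -> even_gap n.+2 -> odd_gap n.+2.
Proof.
move=> odd even h.
have AA_neq0 : alpha * (A (h - n.+1%:Z) * A (h + n.+1%:Z + 1)) != 0.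
  by rewrite !mulf_neq0.
apply: (mulfI AA_neq0).
have key := biquadratic_linked (e_biquadratic h) (ebar_linked n).
have WW := W_rec n.+1.
have := even h; have := even (h + 1); have := odd h.
have -> : h + 1 - n.+2%:Z = h - n.+1%:Z by lia.
have -> : h + 1 + n.+2%:Z = h + n.+2%:Z + 1 by lia.
have -> : h + n.+1%:Z + 1 = h + n.+2%:Z by lia.
move=> odd0 evenS even0.
transitivity (alpha ^+ 2 * (A (h - n.+1%:Z) * A (h + n.+2%:Z + 1))
  * (A (h - n.+2%:Z) * A (h + n.+2%:Z))); first by ring.
rewrite odd0 evenS even0.
transitivity ((W n.+2 ^+ 2 * (A h * A (h + 1))) ^+ 2
  * (alpha ^+ 2 * ((e h - ebar n.+2) * (e (h + 1) - ebar n.+2)))); first by ring.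
rewrite key.
transitivity ((W n.+2 * (A h * A (h + 1))) ^+ 2
  * (ebar n.+2 * W n.+2 ^+ 2)
  * ((e h * e (h + 1) - ebar n.+1 * ebar n.+2)
     * (e h * e (h + 1) - ebar n.+2 * ebar n.+3))); first by ring.
by rewrite -WW; ring.
Qed.

Lemma gaps n : even_gap n.+1 /\ odd_gap n.+1.
Proof.
elim: n => [|n [even odd]]; last first.
  by have even' := even_gap_succ even odd; split=> //; apply: odd_gap_succ.
(* Since [ebar 1] is 0, gap 1 is [A_rec] itself, or the product of two instances of it. *)
split=> h; rewrite ebar1 W1 ?W2.
  by rewrite A_rec; ring.
have eA := A_rec h; have := A_rec (h + 1); rewrite addrK => eA1.
apply: (mulfI (mulf_neq0 (A_neq0 h) (A_neq0 (h + 1)))).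
transitivity (alpha * ((A (h - 1) * A (h + 1)) * (A h * A (h + 1 + 1)))).
  by ring.
by rewrite eA eA1; ring.
Qed.

Lemma even_gap_relation n (h : int) :
  A (h - n.+1%:Z) * A (h + n.+1%:Z) =
  W n.+1 ^+ 2 * A (h - 1) * A (h + 1) - W n * W n.+2 * A h ^+ 2.
Proof.
by rewrite (gaps n).1 -mulrA A_rec W_rec; ring.
Qed.

Lemma odd_gap_relation n (h : int) :
  alpha * A (h - n.+1%:Z) * A (h + n.+1%:Z + 1) =
  W n.+1 * W n.+2 * A (h - 1) * A (h + 2) - W n * W n.+3 * A h * A (h + 1).
Proof.
have WW_neq0 := mulf_neq0 (W_neq0 n) (W_neq0 n.+1).
apply: (mulfI (mulf_neq0 WW_neq0 (mulf_neq0 (A_neq0 h) (A_neq0 (h + 1))))).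
have eA := A_rec h; have := A_rec (h + 1); rewrite addrK -addrA => eA1.
rewrite -(mulrA alpha) (gaps n).2.
transitivity ((W n.+1 * W n.+2) ^+ 2
    * ((A (h - 1) * A (h + 1)) * (A h * A (h + 2)))
  - (W n * W n.+2) * (W n.+1 * W n.+3) * (A h * A (h + 1)) ^+ 2); last by ring.
by rewrite eA eA1 !W_rec; ring.
Qed.

End EllipticSequence.

Theorem theorem1 (K : fieldType) (a1 a2 a3 a4 : K) :
  let E := Weierstrass a1 a2 a3 a4 0 in
  let S : point K := Aff 0 0 in
  let e (P : point K) (h : int) : K := - xcoord (ec_add E P (ec_mulz E h S)) in
  let ebar (h : int) : K := - xcoord (ec_mulz E h S) in
  forall (ellE : elliptic E)
    (alpha beta gamma : K)
    (Hconst : forall P : point K, on_curve E P -> forall h : int,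
       ec_add E P (ec_mulz E (h - 1) S) <> Inf ->
       ec_add E P (ec_mulz E h S) <> Inf ->
       ec_add E P (ec_mulz E (h + 1) S) <> Inf ->
       e P (h - 1) * e P h ^+ 2 * e P (h + 1) = alpha ^+ 2 * e P h - beta /\
       (e P (h - 1) + e P (h + 1)) * e P h ^+ 2 = gamma * e P h - alpha ^+ 2)
    (M : point K) (M_on : on_curve E M)
    (M_aff : forall h : int, ec_add E M (ec_mulz E h S) <> Inf)
    (e_neq0 : forall h : int, e M h <> 0)
    (A : int -> K) (A_neq0 : forall h : int, A h <> 0)
    (A_rec : forall h : int, A (h - 1) * A (h + 1) = e M h * A h ^+ 2)
    (S_inf : forall h : int, h <> 0 -> ec_mulz E h S <> Inf)
    (W : int -> K)
    (W_opp : forall h : int, W (- h) = - W h)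
    (W0 : W 0 = 0) (W1 : W 1 = 1) (W2 : W 2 = alpha)
    (W_rec : forall h : int, 1 <= h ->
       W (h - 1) * W (h + 1) = ebar h * W h ^+ 2)
    (h m : int),
    W 1 ^+ 2 * A (h - m) * A (h + m) =
      W m ^+ 2 * A (h - 1) * A (h + 1) - W (m - 1) * W (m + 1) * A h ^+ 2
    /\
    W 1 * W 2 * A (h - m) * A (h + m + 1) =
      W m * W (m + 1) * A (h - 1) * A (h + 2)
        - W (m - 1) * W (m + 2) * A h * A (h + 1).
Proof.
move=> E S e ebar ellE alpha beta gamma Hconst M M_on M_aff e_neq0 A A_neq0 A_rec
  S_inf W W_opp W0 W1 W2 W_rec.
have ebar1 : ebar 1 = 0 by rewrite /ebar /= oppr0.
have e_linked h : linked alpha beta gamma (e M (h - 1)) (e M h) (e M (h + 1)).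
  by apply: Hconst.
have ebar_linked (n : nat) :
    linked alpha beta gamma (ebar n.+1%:Z) (ebar n.+2%:Z) (ebar n.+3%:Z).
  have -> : n.+1%:Z = n.+2%:Z - 1 by lia.
  have -> : n.+3%:Z = n.+2%:Z + 1 by lia.
  (* Taking the point to be O turns [e] into [ebar]; the three indices are positive, so the
     multiples of S are affine. *)
  by apply: (Hconst Inf I n.+2%:Z); apply: S_inf; lia.
have alpha_neq0 : alpha != 0.
  (* If [alpha] is 0, the product relation at [ebar 1 = 0] forces [beta = 0], and then a product of
     nonzero [e M h] vanishes. *)
  apply/eqP => alpha0; have [] := ebar_linked 0%N.
  rewrite ebar1 alpha0 !mul0r expr0n mul0r sub0r => /esym/eqP.
  rewrite oppr_eq0 => /eqP beta0 _; have [/eqP + _] := e_linked 0.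
  rewrite alpha0 beta0 expr0n mul0r subr0 !mulf_eq0.
  by rewrite !(introF eqP (e_neq0 _)).
have {}A_neq0 h : A h != 0 by apply/eqP.
have W_rec' (n : nat) :
    W n%:Z * W n.+2%:Z = ebar n.+1%:Z * W n.+1%:Z ^+ 2.
  rewrite -W_rec //; congr (W _ * W _); lia.
have even n h := even_gap_relation alpha_neq0 e_linked A_neq0 A_rec
  (ebar := fun n => ebar n%:Z) (W := fun n => W n%:Z)
  ebar_linked ebar1 W1 W2 W_rec' n h.
have odd n h := odd_gap_relation alpha_neq0 e_linked A_neq0 A_rec
  (ebar := fun n => ebar n%:Z) (W := fun n => W n%:Z)
  ebar_linked ebar1 W1 W2 W_rec' n h.
have Wm1 : W (-1) = -1 by rewrite W_opp W1.
have evenN (n : nat) h : A (h - n%:Z) * A (h + n%:Z) =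
    W n%:Z ^+ 2 * A (h - 1) * A (h + 1)
      - W (n%:Z - 1) * W (n%:Z + 1) * A h ^+ 2.
  case: n => [|n]; last first.
    by rewrite even; congr (_ - W _ * W _ * _); lia.
  by rewrite subr0 W0 sub0r add0r Wm1 W1; ring.
have oddN (n : nat) h : alpha * A (h - n%:Z) * A (h + n%:Z + 1) =
    W n%:Z * W (n%:Z + 1) * A (h - 1) * A (h + 2)
      - W (n%:Z - 1) * W (n%:Z + 2) * A h * A (h + 1).
  case: n => [|n]; last first.
    rewrite odd; congr (_ * W _ * _ * _ - W _ * W _ * _ * _); lia.
  by rewrite subr0 W0 sub0r add0r Wm1 W2; ring.
move=> h m; rewrite W1 W2 expr1n !mul1r; case: m => n; first by split.
rewrite NegzE; split.
  (* The even relation is invariant under [m |-> - m]. *)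
  rewrite opprK mulrC evenN W_opp sqrrN.
  have -> : - n.+1%:Z - 1 = - (n.+1%:Z + 1) by lia.
  have -> : - n.+1%:Z + 1 = - (n.+1%:Z - 1) by lia.
  by rewrite !W_opp; ring.
(* The odd relation is invariant under [m |-> - m - 1]. *)
rewrite opprK.
have -> : h - n.+1%:Z + 1 = h - n%:Z by lia.
have -> : h + n.+1%:Z = h + n%:Z + 1 by lia.
rewrite mulrAC oddN.
have -> : - n.+1%:Z - 1 = - (n%:Z + 2) by lia.
have -> : - n.+1%:Z + 1 = - n%:Z by lia.
have -> : - n.+1%:Z + 2 = - (n%:Z - 1) by lia.
have -> : n.+1%:Z = n%:Z + 1 by lia.
by rewrite !W_opp; ring.
Qed.
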